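(* Let $d, k$ be positive integers and let $f:\mathcal{U}(d)\to\mathbb{C}$ be a polynomial of degree $K$ in the matrix elements of $U\in\mathcal{U}(d)$. Write $f(U)=\sum_i \alpha_i M_i(U)$ as a finite sum, where the $M_i$ are (balanced) monomials of degree at most $K$ and $\alpha_i\in\mathbb{C}$, and let $\alpha(f)=\sum_i|\alpha_i|$. Let $\mu$ be a constant and suppose that there are constants $C$ and $a>0$ such that, for all $\delta>0$, $$\mathbb{P}_H(|f-\mu|\ge\delta)\le C e^{-a\delta^2}.$$ Let $\nu$ be an $\epsilon$-approximate unitary $k$-design on $\mathcal{U}(d)$. Then for every $\delta>0$ and every positive integer $m$ with $2mK\le k$, $$\mathbb{P}_\nu(|f-\mu|\ge\delta)\le\frac{1}{\delta^{2m}}\left(C\left(\frac{m}{a}\right)^m+\frac{\epsilon}{d^k}\left(\alpha(f)+|\mu|\right)^{2m}\right).$$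
   Context: $\mathcal{U}(d)$ is the group of $d\times d$ unitary matrices. $\mathbb{P}_H,\mathbb{E}_H$ denote probability and expectation when $U$ is Haar distributed on $\mathcal{U}(d)$; $\mathbb{P}_\nu,\mathbb{E}_\nu$ denote those when $U$ is drawn from the probability distribution $\nu$ on $\mathcal{U}(d)$. A monomial in the elements of $U$ is a product of matrix elements $U_{ij}$ and conjugated matrix elements $U_{pq}^*$; it has degree $(k_1,k_2)$ if it contains $k_1$ conjugated and $k_2$ unconjugated elements, and is balanced if $k_1=k_2$; a balanced monomial of degree $(k,k)$ is simply said to have degree $k$. A polynomial is of degree $K$ if it is a sum (with coefficients) of balanced monomials of degree at most $K$. A probability distribution $\nu$ on $\mathcal{U}(d)$ is an $\epsilon$-approximate unitary $k$-design if for all balanced monomials $M$ of degree $\le k$, $|\mathbb{E}_\nu M(U)-\mathbb{E}_H M(U)|\le \epsilon/d^k$. *)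

(* Defs.v *)
From HB Require Import structures.
From mathcomp Require Import all_boot all_order all_algebra.
From mathcomp Require Import complex.
From mathcomp Require Import all_classical all_reals all_analysis.

Set Implicit Arguments.
Unset Strict Implicit.
Unset Printing Implicit Defensive.

Import Order.TTheory GRing.Theory Num.Theory.
Import numFieldNormedType.Exports.

Local Open Scope classical_set_scope.
Local Open Scope ring_scope.

(* The library only equips abstract numFieldTypes with their norm topology;
   these instances transfer it to the concrete type R[i], and hence to
   matrices over R[i]. *)
HB.instance Definition _ (R : rcfType) := GRing.ComAlgebra.copy R[i] R[i]^o.
HB.instance Definition _ (R : rcfType) := Vector.copy R[i] R[i]^o.
HB.instance Definition _ (R : rcfType) := NormedModule.copy R[i] R[i]^o.

Section UnitaryGroup.
Variables (R : realType) (d : nat).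

Record unitary := Unitary {
  umx :> 'M[R[i]]_d;
  umx_unitary : umx \is unitarymx }.

HB.instance Definition _ := [isSub for umx].
HB.instance Definition _ := [Choice of unitary by <:].

Fact unitary1_subproof : (1%:M : 'M[R[i]]_d) \is unitarymx.
Proof. by apply/unitarymxP; rewrite trmx1 map_mx1 mulmx1. Qed.

Definition unitary1 : unitary := Unitary unitary1_subproof.

Definition unitary_mul (U V : unitary) : unitary :=
  Unitary (mul_unitarymx (umx_unitary U) (umx_unitary V)).

HB.instance Definition _ := isPointed.Build unitary unitary1.

(* Subspace topology of the d x d complex matrices, and its Borel sets. *)
HB.instance Definition _ := Topological.copy unitary (initial_topology umx).
HB.instance Definition _ :=
  Measurable.copy unitary (g_sigma_algebraType (@open unitary)).

(* Left invariance characterizes the Haar probability measure of U(d) among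
   all Borel probability measures. *)
Definition is_haar (H : probability unitary R) : Prop :=
  forall (V : unitary) (A : set unitary), measurable A ->
    H (unitary_mul V @^-1` A) = H A.

End UnitaryGroup.

(* The monomial prod_(p in mon_lin) U_p * prod_(p in mon_conj) (U_p)^*,
   factors being repeated according to multiplicity. *)
Record monomial (d : nat) := Monomial {
  mon_conj : seq ('I_d * 'I_d);
  mon_lin : seq ('I_d * 'I_d) }.

Definition bidegree (d : nat) (M : monomial d) : nat * nat :=
  (size (mon_conj M), size (mon_lin M)).

Definition balanced_of_degree (d k : nat) (M : monomial d) : Prop :=
  bidegree M = (k, k).

Definition balanced_le (d k : nat) (M : monomial d) : Prop :=
  exists2 j : nat, (j <= k)%N & balanced_of_degree j M.

Definition mon_eval (R : realType) (d : nat) (M : monomial d)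
    (U : unitary R d) : R[i] :=
  (\prod_(p <- mon_lin M) U p.1 p.2) *
  (\prod_(p <- mon_conj M) Num.conj (U p.1 p.2)).

Definition complex_expectation (disp : measure_display)
    (T : measurableType disp) (R : realType) (P : probability T R)
    (X : T -> R[i]) : R[i] :=
  Complex (fine 'E_P[fun t => complex.Re (X t)])
          (fine 'E_P[fun t => complex.Im (X t)]).

(* H is meant to be the Haar measure; Normc.normc is the real-valued modulus. *)
Definition approx_design (R : realType) (d k : nat) (eps : R)
    (H nu : probability (unitary R d) R) : Prop :=
  forall M : monomial d, balanced_le k M ->
    Normc.normc (complex_expectation nu (mon_eval M)
                 - complex_expectation H (mon_eval M)) <= eps / d%:R ^+ k.

(* Main.v *)
(* Markov's inequality reduces the tail of f - mu under nu to the moment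
   E_nu |f - mu|^(2m). Since |f - mu|^(2m) = ((f - mu) (f - mu)^* )^m is a
   combination of balanced monomials of degree 2mK <= k whose coefficients have
   total modulus (alpha(f) + |mu|)^(2m), the design property lets us replace nu
   by H at the price of the eps / d^k term. Under H the tail bound is integrated
   (layer cake for |f - mu|^(2m)), giving C m! / a^m <= C (m / a)^m. *)
From HB Require Import structures.
Require Import Defs.
From mathcomp Require Import all_boot all_order all_algebra.
From mathcomp Require Import complex.
From mathcomp Require Import all_classical all_reals all_analysis.
From mathcomp Require Import measurable_realfun ring.

Import Order.TTheory GRing.Theory Num.Theory.
Import numFieldNormedType.Exports.

Local Open Scope classical_set_scope.
Local Open Scope ring_scope.

Set Implicit Arguments.
Unset Strict Implicit.

(** Converts the moment constant m! / a^m into the (m / a)^m of the final bound. *)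
Lemma fact_le_expn (m : nat) : (m`! <= m ^ m)%N.
Proof.
elim: m => // -[//|m] IH; rewrite factS expnS leq_mul2l /=.
by rewrite (leq_trans IH)// leq_exp2r.
Qed.

(** * Moments from exponential tails *)

(** For x >= 0 the exponential series gives 1 + x^(n+1) / (n+1)! <= e^x. With x = a t this bounds
    t^n e^(-at) by a constant multiple of 1 / t. *)
Lemma cvg_exprn_expRN (R : realType) (a : R) (n : nat) : 0 < a ->
  (t ^+ n * expR (- a * t)) @[t --> +oo] --> 0.
Proof.
move=> a0; apply/cvgrPdist_le => e e0; near=> t.
have t0 : 0 < t by near: t; exact: nbhs_pinfty_gt.
have at0 : 0 <= a * t by rewrite mulr_ge0// ltW.
rewrite sub0r normrN ger0_norm; last by rewrite mulr_ge0 ?expR_ge0// exprn_ge0// ltW.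
rewrite mulNr expRN ler_pdivrMr ?expR_gt0//.
have := expR_ge1Dxn n at0.
have -> : (a * t) ^+ n.+1 / n.+1`!%:R = t ^+ n * (t * (a ^+ n.+1 / n.+1`!%:R)).
  by rewrite exprMn [t ^+ n.+1]exprSr; ring.
move=> h; pose c := a ^+ n.+1 / n.+1`!%:R.
apply: (@le_trans _ _ (e * (t ^+ n * (t * c)))); last first.
  by rewrite ler_pM2l//; apply: le_trans h; rewrite lerDr.
rewrite mulrCA -[leLHS]mulr1 ler_pM2l ?exprn_gt0//.
rewrite mulrCA -ler_pdivrMr; last first.
  by rewrite mulr_gt0// divr_gt0 ?exprn_gt0// ltr0n fact_gt0.
by near: t; apply: nbhs_pinfty_ge; rewrite num_real.
Unshelve. all: by end_near. Qed.

(** Integration by parts gives the recursion G_(n+1) = -(1/a) t^(n+1) e^(-at) + ((n+1)/a) G_n. The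
    primitive is normalised to vanish at infinity, so -G(0) is the Gamma integral of t^n e^(-at)
    over the half-line. *)
Lemma exprn_expRN_primitive (R : realType) (a : R) (n : nat) : 0 < a ->
  exists G : R -> R,
    [/\ forall t : R, is_derive t 1 G (t ^+ n * expR (- a * t)),
        G 0 = - (n`!%:R / a ^+ n.+1) & G t @[t --> +oo] --> 0].
Proof.
move=> a0; have aN0 : a != 0 by rewrite gt_eqF.
have dE (t : R) : is_derive t 1 (fun t => expR (- a * t)) (- a * expR (- a * t)).
  have := @is_derive1_comp R expR (fun t => - a * t) t (expR (- a * t)) (- a)
    (is_derive_expR _).
  rewrite mulrC; apply.
  have := @is_deriveZ _ _ _ (fun x : R => x) (- a) t 1 1 (is_derive_id _ _).
  by rewrite /= [(- a) *: (1:R)]mulr1.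
elim: n => [|n [G [dG G0 Goo]]].
  exists (fun t => - a^-1 * expR (- a * t)); split.
  - move=> t.
    have := @is_deriveZ _ _ _ _ (- a^-1) t 1 _ (dE t).
    move=> h; apply: (is_derive_eq h).
    by rewrite expr0 mul1r [LHS]mulrA mulrNN mulVf// mul1r.
  - by rewrite mulr0 expR0 mulr1 expr1 div1r.
  - rewrite -(mulr0 (- a^-1)); apply: cvgMr.
    have := cvg_exprn_expRN 0 a0.
    by under eq_fun do rewrite expr0 mul1r.
exists (fun t => - a^-1 * (t ^+ n.+1 * expR (- a * t)) + (n.+1%:R / a) * G t); split.
- move=> t.
  have dX : is_derive t 1 (fun t : R => t ^+ n.+1) (n.+1%:R * t ^+ n).
    have := @is_deriveX _ _ (fun x : R => x) n.+1 t 1 1 (is_derive_id _ _).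
    by rewrite /= [_ *: (1:R)]mulr1 exprfctE.
  have := @is_deriveD _ _ _ _ _ _ _ _ _
    (@is_deriveZ _ _ _ _ (- a^-1) t 1 _ (is_deriveM dX (dE t)))
    (@is_deriveZ _ _ _ _ (n.+1%:R / a) t 1 _ (dG t)).
  move=> h; apply: (is_derive_eq h).
  rewrite /GRing.scale /=; field; exact: aN0.
- rewrite exprS !mul0r mulr0 add0r G0 factS natrM [a ^+ n.+2]exprS; field.
  by rewrite expf_neq0.
- rewrite -[X in _ --> X](addr0 (0:R)).
  rewrite -{1}(mulr0 (- a^-1)) -{2}(mulr0 (n.+1%:R / a)).
  by apply: cvgD; apply: cvgMr => //; exact: cvg_exprn_expRN.
Qed.

(* With s = r^(1/(m+1)) and G' = s^m e^(-as), one has dr = (m+1) s^m ds, so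
   (m+1) G(s) is a primitive of e^(-as) as a function of r. *)
Lemma integral_expRN_root (R : realType) (a : R) (m : nat) : 0 < a ->
  (\int[lebesgue_measure]_(r in `[(0:R)%R, +oo[)
     (expR (- a * r `^ m.+1%:R^-1))%:E = (m.+1`!%:R / a ^+ m.+1)%:E)%E.
Proof.
move=> a0; have [G [dG G0 Goo]] := exprn_expRN_primitive m a0.
have m0 : (m.+1%:R : R) != 0 by rewrite pnatr_eq0.
pose p : R := m.+1%:R^-1.
have p0 : 0 < p by rewrite invr_gt0 ltr0n.
have powK (r : R) : 0 <= r -> (r `^ p) ^+ m.+1 = r.
  by move=> r0; rewrite -powR_mulrn ?powR_ge0// -powRrM mulVf// powRr1.
have cG : continuous G.
  by move=> t; apply/differentiable_continuous/derivable1_diffP; exact: ex_derive.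
have cE (s : R) : {for s, continuous (fun r => expR (- a * r))}.
  apply: (@continuous_comp _ _ _ (fun r : R => - a * r) expR).
    exact: mulrl_continuous.
  exact: continuous_expR.
have dP (r : R) : 0 < r -> is_derive r 1 (fun r => r `^ p) (p * r `^ (p - 1)).
  exact: is_derive1_powR.
have cvg0 : r `^ p @[r --> (0:R)^'+] --> (0:R) `^ p.
  by rewrite powR0 ?gt_eqF//; exact: powR_cvg0.
have cP (r : R) : 0 < r -> {for r, continuous (fun r => r `^ p)}.
  move=> r0; have h := dP _ r0.
  by apply/differentiable_continuous/derivable1_diffP; exact: ex_derive.
(* The two zeros are the lower endpoint and the limit of the primitive at infinity. At the endpoint
   only continuity from the right is asked, which matters since the root need not be differentiable
   at 0. *)
rewrite (@ge0_continuous_FTC2y _ _ (fun r => m.+1%:R * G (r `^ p)) 0 0).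
- by rewrite powR0 ?gt_eqF// G0 sub0e -EFinN factS natrM; congr EFin; ring.
- by move=> x _; exact: expR_ge0.
- apply/continuous_within_itvcyP; split.
    move=> r; rewrite in_itv/= andbT => r0.
    exact: (continuous_comp (cP _ r0) (cE _)).
  exact: (cvg_comp _ _ cvg0 (cE _)).
- rewrite -(mulr0 m.+1%:R); apply: cvgMr.
  apply: (cvg_comp _ _ _ Goo); apply/cvgryPge => A.
  (* Passing to max(A, 0) makes both sides nonnegative, so they can be compared through their
     (m+1)-st powers. *)
  near=> r; apply: (@le_trans _ _ (Num.max A 0)); first by rewrite le_max lexx.
  have r0 : 0 <= r by near: r; exact: nbhs_pinfty_ge.
  rewrite -(@ler_pXn2r _ m.+1) ?nnegrE ?powR_ge0 ?le_max ?lexx ?orbT//.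
  by rewrite powK//; near: r; apply: nbhs_pinfty_ge; rewrite num_real.
- move=> r r0; have h := is_deriveZ m.+1%:R (is_derive1_comp (dG _) (dP _ r0)).
  exact: (@ex_derive _ _ _ _ _ _ _ h).
- by apply: cvgMr; exact: (cvg_comp _ _ cvg0 (cG _)).
- move=> r; rewrite in_itv/= andbT => r0.
  have h := is_deriveZ m.+1%:R (is_derive1_comp (dG _) (dP _ r0)).
  rewrite derive1E (@derive_val _ _ _ _ _ _ _ h) /GRing.scale /=.
  (* The Jacobian cancels: m p + p - 1 = (m+1) p - 1 = 0. *)
  have key : (r `^ p) ^+ m * r `^ (p - 1) = 1.
    rewrite -powR_mulrn ?powR_ge0// -powRrM -powRD; last first.
      by rewrite (gt_eqF r0) implybT.
    have -> : p * m%:R + (p - 1) = p * m.+1%:R - 1 by rewrite -natr1; ring.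
    by rewrite mulVf// subrr powRr0.
  transitivity ((m.+1%:R * p) * ((r `^ p) ^+ m * r `^ (p - 1))
    * expR (- a * r `^ p)); first by ring.
  by rewrite mulfV// key !mul1r.
Unshelve. all: by end_near. Qed.

(** Evaluating the tail bound at u = 1 fixes the sign of C: a measure is nonnegative and the
    exponential is positive. This sign allows C to be pulled out of integrals and multiplied into
    inequalities. *)
Lemma tail_const_ge0 d (T : measurableType d) (R : realType)
    (P : {measure set T -> \bar R}) (Y : T -> R) (C a : R) :
  (forall u, 0 < u -> (P [set t | (u <= Y t)%R] <= (C * expR (- a * u))%:E)%E) ->
  0 <= C.
Proof.
move=> /(_ 1 ltr01) /(le_trans (measure_ge0 _ _)).
by rewrite lee_fin pmulr_lge0// expR_gt0.
Qed.

(* Layer cake: E[Y^(m+1)] is the integral over r > 0 of P(Y > r^(1/(m+1))). *)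
Lemma moment_le_of_tail d (T : measurableType d) (R : realType)
    (P : probability T R) (Y : T -> R) (C a : R) (m : nat) :
  measurable_fun setT Y -> (forall t, 0 <= Y t) -> 0 < a ->
  (forall u, 0 < u -> (P [set t | (u <= Y t)%R] <= (C * expR (- a * u))%:E)%E) ->
  ('E_P[fun t => (Y t ^+ m.+1)%R] <= (C * (m.+1`!%:R / a ^+ m.+1))%:E)%E.
Proof.
move=> mY Y0 a0 tailY.
have C0 := tail_const_ge0 tailY.
have mZ : measurable_fun setT (fun t => (Y t ^+ m.+1)%R) by exact: measurable_funX.
pose Z : {mfun T >-> R} := HB.pack (fun t => Y t ^+ m.+1)
  (isMeasurableFun.Build _ _ _ _ _ mZ).
rewrite (@ge0_expectation_ccdf _ _ _ P Z) /=; last by move=> t; exact: exprn_ge0.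
(* The endpoint r = 0 is removed because the tail bound is only available at positive levels. *)
rewrite -integral_itv_obnd_cbnd; last first.
  by apply: measurable_funTS; exact: ccdf_measurable.
have mexp : measurable_fun setT (fun r : R => expR (- a * r `^ m.+1%:R^-1)).
  have mp := measurable_funM (measurable_cst (- a)) (@measurable_powR R m.+1%:R^-1).
  exact: (measurableT_comp (@measurable_expR R) mp).
have -> : (C * (m.+1`!%:R / a ^+ m.+1))%:E =
    (\int[lebesgue_measure]_(r in `](0:R)%R, +oo[)
       (C%:E * (expR (- a * r `^ m.+1%:R^-1))%:E))%E.
  rewrite ge0_integralZl//=.
  + rewrite integral_itv_obnd_cbnd ?integral_expRN_root//.
    by apply/measurable_EFinP; exact: measurable_funTS.
  + by apply/measurable_EFinP; exact: measurable_funTS.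
apply: ge0_le_integral => //=.
- by apply: measurable_funTS; exact: ccdf_measurable.
- by apply/measurable_EFinP; apply: measurable_funM => //; exact: measurable_funTS.
move=> r; rewrite /= in_itv/= andbT => r0.
rewrite -EFinM; apply: le_trans (tailY _ (powR_gt0 _ r0)).
have mge : measurable [set t | (r `^ m.+1%:R^-1 <= Y t)%R].
  rewrite -[X in measurable X]setTI.
  exact: (measurable_fun_ler (measurable_cst _) mY measurableT (Y := [set true])).
have mgt : measurable (Z @^-1` `]r, +oo[).
  by rewrite -[X in measurable X]setTI; exact: (measurable_funPT Z).
(* The ccdf uses the strict event Y^(m+1) > r, which lies inside the event Y >= r^(1/(m+1)) of the
   tail hypothesis. *)
apply: (@le_measure _ _ _ P (Z @^-1` `]r, +oo[%classic)
  [set t | (r `^ m.+1%:R^-1 <= Y t)%R]); rewrite ?inE//.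
move=> t /=; rewrite in_itv/= andbT => rY.
rewrite -(@ler_pXn2r _ m.+1) ?nnegrE ?powR_ge0// -powR_mulrn ?powR_ge0//.
by rewrite -powRrM mulVf ?pnatr_eq0// powRr1 ltW.
Qed.

(** * Bounded complex random variables *)

Lemma normCE (R : rcfType) (z : R[i]) : `|z| = (Normc.normc z)%:C%C.
Proof. by []. Qed.

Lemma normc_ge0 (R : rcfType) (z : R[i]) : 0 <= Normc.normc z.
Proof. by rewrite -lecR -normCE normr_ge0. Qed.

Lemma Re_conj (R : rcfType) (z : R[i]) : complex.Re (Num.conj z) = complex.Re z.
Proof. by case: z. Qed.

Lemma Im_conj (R : rcfType) (z : R[i]) : complex.Im (Num.conj z) = - complex.Im z.
Proof. by case: z. Qed.

Lemma normc_conj (R : rcfType) (z : R[i]) : Normc.normc (Num.conj z) = Normc.normc z.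
Proof. by apply: (@complexI R); rewrite -!normCE norm_conjC. Qed.

Lemma le_Re_normc (R : rcfType) (z : R[i]) : `|complex.Re z| <= Normc.normc z.
Proof. by rewrite -lecR -normCE normc_ge_Re. Qed.

(** Follows from the bound on real parts, since Re(i z) = -Im z and |i| = 1. *)
Lemma le_Im_normc (R : rcfType) (z : R[i]) : `|complex.Im z| <= Normc.normc z.
Proof.
have := le_Re_normc (z * 'i%C).
rewrite ReiNIm normrN Normc.normcM -[Normc.normc 'i%C]/(complex.Re `|'i%C|).
by rewrite complexiE normCi mulr1.
Qed.

Lemma mul_conj_normc (R : rcfType) (z : R[i]) :
  z * Num.conj z = (Normc.normc z ^+ 2)%:C%C.
Proof. by rewrite -normCK rmorphXn. Qed.

Lemma ReB (R : rcfType) (z w : R[i]) :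
  complex.Re (z - w) = complex.Re z - complex.Re w.
Proof. by case: z w => ? ? []. Qed.

Lemma ImB (R : rcfType) (z w : R[i]) :
  complex.Im (z - w) = complex.Im z - complex.Im w.
Proof. by case: z w => ? ? []. Qed.

Lemma normc_sum_le (R : rcfType) (I : finType) (c : I -> R[i]) :
  Normc.normc (\sum_i c i) <= \sum_i Normc.normc (c i).
Proof. by rewrite -lecR rmorph_sum /=; exact: (@ler_norm_sum _ R[i]). Qed.

(** * Continuity and Borel measurability of matrix entries *)

(** The balls of [R[i]] are taken for its [R[i]]-valued norm, so the real radius is embedded as
    [e%:C] and the comparison is carried back to the real modulus. *)
Lemma continuous_normc_lipschitz (R : realType) (F : R[i] -> R) :
  (forall z w, `|F z - F w| <= Normc.normc (z - w)) -> continuous F.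
Proof.
move=> lipF z; apply/(@cvgrPdist_lt _ _ _ _ (@nbhs_filter R[i] z)) => e e0.
have e0' : 0 < e%:C%C :> R[i] by rewrite ltcR.
have nz : \forall w \near z, `|z - w| < e%:C%C := nbhsx_ballx z _ e0'.
by apply: filterS nz => w; rewrite normCE ltcR; exact: le_lt_trans.
Qed.

Lemma continuous_Re (R : realType) : continuous (@complex.Re R : R[i] -> R).
Proof.
by apply: continuous_normc_lipschitz => z w; rewrite -ReB; exact: le_Re_normc.
Qed.

Lemma continuous_Im (R : realType) : continuous (@complex.Im R : R[i] -> R).
Proof.
by apply: continuous_normc_lipschitz => z w; rewrite -ImB; exact: le_Im_normc.
Qed.

(** The diagonal entry (i, i) of U U^* = 1 says that row i has unit norm, so each |U_ij|^2 is at
    most 1. *)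
Lemma normc_unitary_le1 (R : realType) (d : nat) (U : unitary R d) (i j : 'I_d) :
  Normc.normc (U i j) <= 1.
Proof.
rewrite -(@lecR R) -normCE -(@expr_le1 _ 2)//.
have /unitarymxP/matrixP/(_ i i) := umx_unitary U.
rewrite !mxE eqxx mulr1n => <-.
under eq_bigr do rewrite !mxE -normCK.
by rewrite (bigD1 j)//= lerDl sumr_ge0// => k _; rewrite exprn_ge0.
Qed.

Lemma continuous_unitary_entry (R : realType) (d : nat) (i j : 'I_d) :
  continuous (fun U : unitary R d => U i j : R[i]).
Proof.
move=> U.
have cM : {for umx U, continuous (fun M : 'M[R[i]]_d => M i j)}.
  exact: coord_continuous.
have cU : {for U, continuous (@umx R d)} by exact: initial_continuous.
exact: (continuous_comp cU cM).
Qed.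

(** Open intervals generate the Borel sets of the line, and their preimages are open, hence among
    the generators of the sigma-algebra on the group. *)
Lemma measurable_unitary_continuous (R : realType) (d : nat) (g : unitary R d -> R) :
  continuous g -> measurable_fun [set: unitary R d] g.
Proof.
move=> cg; apply: (@measurability _ _ _ _ _ g _ (@RGenOpens.measurableE R)).
move=> _ [_ [a [b ->]] <-]; rewrite setTI.
apply: sub_sigma_algebra.
by move/continuousP : cg; apply; exact: interval_open.
Qed.

(** The components are treated separately to match [complex_expectation]. The uniform bound gives
    integrability under every probability and, unlike integrability, is stable under products. *)
Definition bounded_measurable d (T : measurableType d) (R : realType)
    (g : T -> R[i]) : Prop :=
  [/\ measurable_fun setT (fun t => complex.Re (g t)),
      measurable_fun setT (fun t => complex.Im (g t))
    & exists B : R, forall t, Normc.normc (g t) <= B].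

Section BoundedMeasurable.
Context d (T : measurableType d) (R : realType).
Implicit Types (g h : T -> R[i]) (P : probability T R).

Lemma bounded_measurable_cst (c : R[i]) : bounded_measurable (fun _ : T => c).
Proof. by split; [exact: measurable_cst..|exists (Normc.normc c)]. Qed.

Lemma bounded_measurableD g h : bounded_measurable g ->
  bounded_measurable h -> bounded_measurable (fun t => g t + h t).
Proof.
move=> [gR gI [A gA]] [hR hI [B hB]]; split.
- rewrite (_ : (fun t => _) = (fun t => complex.Re (g t) + complex.Re (h t))).
    exact: measurable_funD.
  by apply/funext => t; case: (g t) (h t) => ? ? [].
- rewrite (_ : (fun t => _) = (fun t => complex.Im (g t) + complex.Im (h t))).
    exact: measurable_funD.
  by apply/funext => t; case: (g t) (h t) => ? ? [].
- by exists (A + B) => t; rewrite (le_trans (le_normcD _ _))// lerD.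
Qed.

Lemma bounded_measurableM g h : bounded_measurable g ->
  bounded_measurable h -> bounded_measurable (fun t => g t * h t).
Proof.
move=> [gR gI [A gA]] [hR hI [B hB]]; split.
- rewrite (_ : (fun t => _) = (fun t => complex.Re (g t) * complex.Re (h t)
    - complex.Im (g t) * complex.Im (h t))).
    by apply: measurable_funB; exact: measurable_funM.
  by apply/funext => t; case: (g t) (h t) => ? ? [].
- rewrite (_ : (fun t => _) = (fun t => complex.Re (g t) * complex.Im (h t)
    + complex.Im (g t) * complex.Re (h t))).
    by apply: measurable_funD; exact: measurable_funM.
  by apply/funext => t; case: (g t) (h t) => ? ? [].
- by exists (A * B) => t; rewrite Normc.normcM ler_pM ?normc_ge0.
Qed.

Lemma bounded_measurable_conj g : bounded_measurable g ->
  bounded_measurable (fun t => Num.conj (g t)).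
Proof.
move=> [gR gI [A gA]]; split.
- by under eq_fun do rewrite Re_conj.
- under eq_fun do rewrite Im_conj; exact: measurable_funN.
- by exists A => t; rewrite normc_conj.
Qed.

Lemma bounded_measurable_prod (I : Type) (s : seq I) (g : I -> T -> R[i]) :
  (forall i, bounded_measurable (g i)) ->
  bounded_measurable (fun t => \prod_(i <- s) g i t).
Proof.
move=> hg; elim: s => [|i s IH].
  by under eq_fun do rewrite big_nil; exact: bounded_measurable_cst.
by under eq_fun do rewrite big_cons; exact: bounded_measurableM.
Qed.

Lemma bounded_measurable_sum (I : Type) (s : seq I) (g : I -> T -> R[i]) :
  (forall i, bounded_measurable (g i)) ->
  bounded_measurable (fun t => \sum_(i <- s) g i t).
Proof.
move=> hg; elim: s => [|i s IH].
  by under eq_fun do rewrite big_nil; exact: bounded_measurable_cst.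
by under eq_fun do rewrite big_cons; exact: bounded_measurableD.
Qed.

(** * Integrability and linearity of the complex expectation *)

Lemma bounded_measurable_integrable P g : bounded_measurable g ->
  P.-integrable setT (EFin \o (fun t => complex.Re (g t))) /\
  P.-integrable setT (EFin \o (fun t => complex.Im (g t))).
Proof.
move=> [gR gI [A gA]]; split; apply: measurable_bounded_integrable => //.
- exact: le_lt_trans (probability_le1 P measurableT) (ltry 1).
- exists A; split; first exact: num_real.
  by move=> B AB t _ /=; exact: le_trans (le_Re_normc _) (le_trans (gA t) (ltW AB)).
- exact: le_lt_trans (probability_le1 P measurableT) (ltry 1).
- exists A; split; first exact: num_real.
  by move=> B AB t _ /=; exact: le_trans (le_Im_normc _) (le_trans (gA t) (ltW AB)).
Qed.

Lemma complex_expectationD P g h : bounded_measurable g -> bounded_measurable h ->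
  complex_expectation P (fun t => g t + h t) =
  complex_expectation P g + complex_expectation P h.
Proof.
move=> /(bounded_measurable_integrable P)[gR gI].
move=> /(bounded_measurable_integrable P)[hR hI].
rewrite /complex_expectation unlock.
apply/eqP; rewrite eq_complex /=; apply/andP; split; apply/eqP.
- rewrite -fineD ?integrable_fin_num// -integralD//.
  by congr fine; apply: eq_integral => t _ /=; case: (g t) (h t) => ? ? [].
- rewrite -fineD ?integrable_fin_num// -integralD//.
  by congr fine; apply: eq_integral => t _ /=; case: (g t) (h t) => ? ? [].
Qed.

Lemma complex_expectationZ P (c : R[i]) g : bounded_measurable g ->
  complex_expectation P (fun t => c * g t) = c * complex_expectation P g.
Proof.
move=> /(bounded_measurable_integrable P)[gR gI].
case: c => x y; rewrite /complex_expectation unlock.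
(* For c = x + i y, this real-linear identity serves both components: (u, v) = (x, -y) for the real
   part and (y, x) for the imaginary part. *)
have Z (u v : R) :
    (\int[P]_t (u * complex.Re (g t) + v * complex.Im (g t))%R%:E =
     (u * fine (\int[P]_t (complex.Re (g t))%:E)
      + v * fine (\int[P]_t (complex.Im (g t))%:E))%R%:E)%E.
  under eq_integral do rewrite EFinD !EFinM.
  rewrite integralD//; [|exact: integrableZl..].
  by rewrite !integralZl// EFinD !EFinM !fineK// integrable_fin_num.
apply/eqP; rewrite eq_complex /=; apply/andP; split; apply/eqP.
- rewrite -mulNr -[RHS]/(fine (_%:E)) -Z.
  by congr fine; apply: eq_integral => t _ /=; case: (g t) => ? ? /=; rewrite mulNr.
- rewrite addrC -[RHS]/(fine (_%:E)) -Z.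
  by congr fine; apply: eq_integral => t _ /=; case: (g t) => ? ? /=; rewrite addrC.
Qed.

Lemma complex_expectation_sum P (I : Type) (s : seq I) (c : I -> R[i])
    (g : I -> T -> R[i]) :
  (forall i, bounded_measurable (g i)) ->
  complex_expectation P (fun t => \sum_(i <- s) c i * g i t)
  = \sum_(i <- s) c i * complex_expectation P (g i).
Proof.
move=> hg.
have hcg i : bounded_measurable (fun t => c i * g i t).
  by apply: bounded_measurableM => //; exact: bounded_measurable_cst.
elim: s => [|i s IH].
  under eq_fun do rewrite big_nil.
  by rewrite big_nil /complex_expectation !expectation_cst.
under eq_fun do rewrite big_cons.
rewrite big_cons complex_expectationD//; last exact: bounded_measurable_sum.
by rewrite complex_expectationZ// IH.
Qed.

End BoundedMeasurable.

(** * Combinations of balanced monomials *)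

Section MonomialCombination.
Context (R : realType) (d : nat).
Implicit Types (g h : unitary R d -> R[i]).

Lemma bounded_measurable_entry (i j : 'I_d) :
  bounded_measurable (fun U : unitary R d => U i j).
Proof.
split.
- apply: measurable_unitary_continuous => U.
  exact: continuous_comp (@continuous_unitary_entry R d i j U)
    (@continuous_Re R _).
- apply: measurable_unitary_continuous => U.
  exact: continuous_comp (@continuous_unitary_entry R d i j U)
    (@continuous_Im R _).
- by exists 1 => U; exact: normc_unitary_le1.
Qed.

Lemma bounded_measurable_mon_eval (M : monomial d) :
  bounded_measurable (@mon_eval R d M).
Proof.
apply: bounded_measurableM; apply: bounded_measurable_prod => p.
  exact: bounded_measurable_entry.
by apply: bounded_measurable_conj; exact: bounded_measurable_entry.
Qed.

(* A plays the role of alpha(g). *)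
Definition monomial_comb (K : nat) (A : R) g : Prop :=
  exists (I : finType) (c : I -> R[i]) (M : I -> monomial d),
    [/\ forall i, balanced_le K (M i),
        forall U, g U = \sum_i c i * mon_eval (M i) U
      & \sum_i Normc.normc (c i) = A].

(** The empty monomial is balanced of degree 0 and evaluates to 1. This accounts for the
    contribution |mu| to the total coefficient weight. *)
Lemma monomial_comb_cst (c : R[i]) : monomial_comb 0 (Normc.normc c) (fun=> c).
Proof.
exists unit, (fun=> c), (fun=> Monomial [::] [::]); split.
- by move=> _; exists 0%N.
- by move=> U; rewrite big_const card_unit /= /mon_eval !big_nil !mulr1 addr0.
- by rewrite big_const card_unit /= addr0.
Qed.

Lemma monomial_comb_le K L A g : (K <= L)%N ->
  monomial_comb K A g -> monomial_comb L A g.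
Proof.
move=> KL [I [c [M [hM hg hA]]]]; exists I, c, M; split=> // i.
by have [j jK ?] := hM i; exists j => //; exact: leq_trans KL.
Qed.

(** Indexing by the disjoint sum keeps repeated monomials apart, so the weights add exactly and no
    cancellation has to be tracked. *)
Lemma monomial_combD K A B g h : monomial_comb K A g -> monomial_comb K B h ->
  monomial_comb K (A + B) (fun U => g U + h U).
Proof.
move=> [I [c [M [hM hg <-]]]] [J [e [N [hN hh <-]]]].
exists (I + J)%type, (fun x => match x with inl i => c i | inr j => e j end),
  (fun x => match x with inl i => M i | inr j => N j end); split.
- by case.
- by move=> U; rewrite big_sumType hg hh.
- by rewrite big_sumType.
Qed.

(** * Products, powers and conjugates of combinations *)

Definition mon_mul (M N : monomial d) : monomial d :=
  Monomial (mon_conj M ++ mon_conj N) (mon_lin M ++ mon_lin N).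

Lemma mon_eval_mul M N (U : unitary R d) :
  mon_eval (mon_mul M N) U = mon_eval M U * mon_eval N U.
Proof. by rewrite /mon_eval !big_cat /= mulrACA. Qed.

Lemma balanced_le_mul K L (M N : monomial d) :
  balanced_le K M -> balanced_le L N -> balanced_le (K + L) (mon_mul M N).
Proof.
move=> [j jK [cM lM]] [l lL [cN lN]]; exists (j + l)%N; first exact: leq_add.
by rewrite /balanced_of_degree /bidegree !size_cat cM lM cN lN.
Qed.

(** Expanding the product over pairs of indices multiplies the coefficient moduli, so the total
    weight factors as A B. *)
Lemma monomial_combM K L A B g h : monomial_comb K A g -> monomial_comb L B h ->
  monomial_comb (K + L) (A * B) (fun U => g U * h U).
Proof.
move=> [I [c [M [hM hg <-]]]] [J [e [N [hN hh <-]]]].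
exists (I * J)%type, (fun x => c x.1 * e x.2),
  (fun x => mon_mul (M x.1) (N x.2)); split.
- by move=> x; exact: balanced_le_mul.
- move=> U; rewrite hg hh big_distrlr pair_big /=.
  by apply: eq_bigr => x _; rewrite mon_eval_mul mulrACA.
- rewrite big_distrlr pair_big /=.
  by apply: eq_bigr => x _; rewrite Normc.normcM.
Qed.

Lemma monomial_combX K A g m : monomial_comb K A g ->
  monomial_comb (m * K) (A ^+ m) (fun U => g U ^+ m).
Proof.
move=> hg; elim: m => [|m IH].
  by rewrite mul0n expr0 -(Normc.normc1 R); exact: (monomial_comb_cst 1).
by rewrite mulSn exprS; under eq_fun do rewrite exprS; exact: monomial_combM.
Qed.

Definition mon_swap (M : monomial d) : monomial d :=
  Monomial (mon_lin M) (mon_conj M).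

Lemma mon_eval_swap M (U : unitary R d) :
  mon_eval (mon_swap M) U = Num.conj (mon_eval M U).
Proof.
rewrite /mon_eval rmorphM !rmorph_prod mulrC; congr (_ * _).
by apply: eq_bigr => p _; exact/esym/conjCK.
Qed.

(** Conjugation exchanges the linear and conjugated factors. The degree is kept because the two
    lists of a balanced monomial have equal length. *)
Lemma monomial_comb_conj K A g : monomial_comb K A g ->
  monomial_comb K A (fun U => Num.conj (g U)).
Proof.
move=> [I [c [M [hM hg <-]]]].
exists I, (fun i => Num.conj (c i)), (fun i => mon_swap (M i)); split.
- move=> i; have [j jK [cM lM]] := hM i; exists j => //.
  by rewrite /balanced_of_degree /bidegree cM lM.
- move=> U; rewrite hg rmorph_sum; apply: eq_bigr => i _.
  by rewrite rmorphM mon_eval_swap.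
- by apply: eq_bigr => i _; rewrite normc_conj.
Qed.

Lemma bounded_measurable_monomial_comb K A g :
  monomial_comb K A g -> bounded_measurable g.
Proof.
move=> [I [c [M [_ hg _]]]].
rewrite (_ : g = fun U => \sum_i c i * mon_eval (M i) U).
  apply: bounded_measurable_sum => i; apply: bounded_measurableM.
    exact: bounded_measurable_cst.
  exact: bounded_measurable_mon_eval.
by apply/funext.
Qed.

(** By linearity and the triangle inequality, each monomial contributes at most its coefficient
    modulus times eps / d^k. *)
Lemma approx_design_monomial_comb (k K : nat) (eps A : R)
    (H nu : probability (unitary R d) R) g :
  approx_design k eps H nu -> (K <= k)%N -> monomial_comb K A g ->
  Normc.normc (complex_expectation nu g - complex_expectation H g)
    <= eps / d%:R ^+ k * A.
Proof.
move=> hnu Kk [I [c [M [hM hg <-]]]].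
have -> : g = fun U => \sum_i c i * mon_eval (M i) U by apply/funext.
have bM i : bounded_measurable (@mon_eval R d (M i)).
  exact: bounded_measurable_mon_eval.
rewrite !complex_expectation_sum//.
rewrite -sumrB (le_trans (normc_sum_le _))// mulr_sumr ler_sum// => i _.
rewrite -mulrBr Normc.normcM mulrC ler_wpM2r ?normc_ge0//.
by apply: hnu; have [j jK ?] := hM i; exists j => //; exact: leq_trans Kk.
Qed.

End MonomialCombination.

(** * Transfer of the tail bound from Haar measure to the design *)

Unset Implicit Arguments.

Theorem theorem1p2 (R : realType) (d k K : nat) (hd : (0 < d)%N) (hk : (0 < k)%N)
  (H : probability (unitary R d) R) (hH : is_haar H)
  (f : unitary R d -> R[i])
  (n : nat) (alpha : 'I_n -> R[i]) (M : 'I_n -> monomial d)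
  (hM : forall i : 'I_n, balanced_le K (M i))
  (hf : forall U : unitary R d, f U = \sum_(i < n) alpha i * mon_eval (M i) U)
  (mu : R[i]) (C a : R) (ha : 0 < a)
  (hconc : forall delta : R, 0 < delta ->
    (H [set U | (delta <= Normc.normc (f U - mu))%R]
       <= (C * expR (- a * delta ^+ 2))%:E)%E)
  (eps : R) (nu : probability (unitary R d) R)
  (hnu : approx_design k eps H nu)
  (delta : R) (hdelta : 0 < delta)
  (m : nat) (hm : (0 < m)%N) (hmK : (2 * m * K <= k)%N) :
  (nu [set U | (delta <= Normc.normc (f U - mu))%R]
     <= ((delta ^+ (2 * m))^-1 *
         (C * (m%:R / a) ^+ m
          + eps / d%:R ^+ k
            * (\sum_(i < n) Normc.normc (alpha i) + Normc.normc mu)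
              ^+ (2 * m)))%:E)%E.
Proof.
pose Y U := Normc.normc (f U - mu) ^+ 2.
pose A := \sum_(i < n) Normc.normc (alpha i) + Normc.normc mu.
(* [q] is [Y] = |f - mu|^2 seen as a complex polynomial: the design condition applies to powers of
   [q], the real moment and Markov bounds to [Y]. *)
pose q U := (f U - mu) * Num.conj (f U - mu).
have Y0 U : 0 <= Y U by exact: exprn_ge0 (normc_ge0 _).
have qE m' U : q U ^+ m' = (Y U ^+ m')%:C%C by rewrite /q mul_conj_normc -rmorphXn.
have fcomb : monomial_comb K (\sum_(i < n) Normc.normc (alpha i)) f.
  by exists 'I_n, alpha, M.
have gcomb : monomial_comb K A (fun U => f U - mu).
  (* The constant -mu has degree 0 and is regarded as a combination of degree at most K so that it
     can be added to f. *)
  have := monomial_comb_le (leq0n K) (monomial_comb_cst d (- mu)).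
  by rewrite normcN; exact: monomial_combD.
have hcomb := monomial_combM gcomb (monomial_comb_conj gcomb).
have qcomb : monomial_comb (m * (K + K)) ((A * A) ^+ m) (fun U => q U ^+ m).
  exact: monomial_combX hcomb.
have mY : measurable_fun setT Y.
  have [+ _ _] := bounded_measurable_monomial_comb hcomb.
  by under eq_fun do rewrite -[X in complex.Re X]expr1 qE expr1.
have geE (u : R) : 0 < u ->
    [set U | (u <= Normc.normc (f U - mu))%R] = [set U | (u ^+ 2 <= Y U)%R].
  move=> u0; apply/seteqP.
  by split=> U; rewrite /Y /= ler_pXn2r ?nnegrE ?normc_ge0 ?(ltW u0).
have Re_q (P : probability (unitary R d) R) :
    complex.Re (complex_expectation P (fun U => q U ^+ m)) =
    fine 'E_P[fun U => (Y U ^+ m)%R].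
  by congr (fine (expectation _ _)); apply/funext => U; rewrite qE.
have Efin (P : probability (unitary R d) R) :
    'E_P[fun U => (Y U ^+ m)%R]%E \is a fin_num.
  have [h _] := bounded_measurable_integrable P
    (bounded_measurable_monomial_comb qcomb).
  have -> : (fun U => Y U ^+ m) = (fun U => complex.Re (q U ^+ m)).
    by apply/funext => U; rewrite qE.
  by rewrite unlock; exact: integrable_fin_num.
have EH : fine 'E_H[fun U => (Y U ^+ m)%R]%E <= C * (m%:R / a) ^+ m.
  (* Taking delta = sqrt u turns the Gaussian tail of |f - mu| into an exponential tail of its
     square. *)
  have tail (u : R) : 0 < u ->
      (H [set U | (u <= Y U)%R] <= (C * expR (- a * u))%:E)%E.
    move=> u0; have s0 : 0 < Num.sqrt u by rewrite sqrtr_gt0.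
    by have := hconc _ s0; rewrite geE// sqr_sqrtr ?(ltW u0).
  (* The moment bound is stated for a successor exponent, so it is applied at m - 1, which is
     legitimate as m > 0. *)
  rewrite -lee_fin fineK// -(prednK hm).
  apply: le_trans (moment_le_of_tail m.-1 mY Y0 ha tail) _.
  have C0 := tail_const_ge0 tail.
  rewrite lee_fin ler_wpM2l// prednK// expr_div_n.
  rewrite ler_wpM2r ?invr_ge0 ?exprn_ge0 ?(ltW ha)//.
  by rewrite -natrX ler_nat fact_le_expn.
have Enu : fine 'E_nu[fun U => (Y U ^+ m)%R]%E <=
    C * (m%:R / a) ^+ m + eps / d%:R ^+ k * A ^+ (2 * m).
  have := approx_design_monomial_comb hnu _ qcomb.
  rewrite addnn -mul2n mulnCA mulnA => /(_ hmK) dev.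
  (* The difference of the two real moments is the real part of the complex deviation, hence bounded
     by its modulus. *)
  have := le_trans (le_Re_normc _) dev.
  rewrite ReB !Re_q => /(le_trans (ler_norm _)).
  rewrite -expr2 -exprM lerBlDl => /le_trans; apply.
  by rewrite lerD2r.
have Markov : ((delta ^+ (2 * m))%:E
    * nu [set U | (delta <= Normc.normc (f U - mu))%R]
    <= 'E_nu[fun U => (Y U ^+ m)%R])%E.
  rewrite geE// exprM.
  pose Y' : {mfun unitary R d >-> R} := HB.pack Y
    (isMeasurableFun.Build _ _ _ _ _ mY).
  (* Markov's inequality is applied to [Y] at level delta^2 with the increasing function x^m, which
     produces the factor delta^(2m). *)
  have := @markov _ _ _ nu Y' (fun x => x ^+ m) (delta ^+ 2) (exprn_gt0 _ hdelta).
  have -> : [set U | ((delta ^+ 2)%:E <= `|(Y' U)%:E|)%E] =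
      [set U | (delta ^+ 2 <= Y U)%R].
    by apply/seteqP; split => U /=; rewrite lee_fin ger0_norm.
  have -> : (fun x => x ^+ m) \o (fun x => `|x|) \o Y' = (fun U => Y U ^+ m).
    by apply/funext => U /=; rewrite ger0_norm.
  apply.
  - exact: measurable_funX.
  - by move=> r; exact: exprn_ge0.
  - by move=> x y; rewrite !nnegrE => x0 y0 xy; rewrite ler_pXn2r.
rewrite EFinM lee_pdivlMl ?exprn_gt0//.
by rewrite (le_trans Markov)// -(fineK (Efin nu)) lee_fin.
Qed.
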